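(* Let $X$ be a matrix, let $p,q,r$ be nonnegative integers, let $I=(i_1,\dots,i_p)$, $J=(j_1,\dots,j_q)$, $K=(k_1,\dots,k_r)$ be sequences of row indices of $X$, and let $I'=(i'_1,\dots,i'_p)$, $J'=(j'_1,\dots,j'_q)$, $K'=(k'_1,\dots,k'_r)$ be sequences of column indices of $X$. Define a $(p+q)\times(p+q)$ matrix $\widetilde{X}=(\widetilde{x}_{\alpha,\beta})_{1\le\alpha,\beta\le p+q}$ by $$\widetilde{x}_{\alpha,\beta}=\det X\begin{pmatrix} (i_\alpha)\sqcup J\sqcup K \\ (i'_\beta)\sqcup J'\sqcup K' \end{pmatrix}\quad(1\le\alpha,\beta\le p),$$ $$\widetilde{x}_{\alpha,p+\beta}=\det X\begin{pmatrix} (i_\alpha)\sqcup(J\setminus(j_\beta))\sqcup K \\ J'\sqcup K' \end{pmatrix}\quad(1\le\alpha\le p,\ 1\le\beta\le q),$$ $$\widetilde{x}_{p+\alpha,\beta}=\det X\begin{pmatrix} J\sqcup K \\ (i'_\beta)\sqcup(J'\setminus(j'_\alpha))\sqcup K' \end{pmatrix}\quad(1\le\alpha\le q,\ 1\le\beta\le p),$$ $$\widetilde{x}_{p+\alpha,p+\beta}=-\det X\begin{pmatrix} (J\setminus(j_\beta))\sqcup K \\ (J'\setminus(j'_\alpha))\sqcup K' \end{pmatrix}\quad(1\le\alpha,\beta\le q).$$ Then $$\det\widetilde{X}=(-1)^q\,\det X\begin{pmatrix} I\sqcup K \\ I'\sqcup K' \end{pmatrix}\cdot\left(\det X\begin{pmatrix}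 J\sqcup K \\ J'\sqcup K' \end{pmatrix}\right)^{p+q-1}.$$
   Context: Matrices have entries in a commutative ring. For a matrix $X=(x_{i,j})$, a sequence $I=(i_1,\dots,i_a)$ of row indices and a sequence $I'=(i'_1,\dots,i'_b)$ of column indices, $X\begin{pmatrix} I \\ I' \end{pmatrix}$ denotes the $a\times b$ matrix $(x_{i_\alpha,i'_\beta})_{1\le\alpha\le a,\,1\le\beta\le b}$. For sequences $I,J$, $I\sqcup J$ denotes their concatenation ($I$ followed by $J$). For $J=(j_1,\dots,j_q)$, $J\setminus(j_\beta)$ denotes the sequence obtained from $J$ by removing the $\beta$-th entry (keeping the order of the others). The determinant of the $0\times0$ matrix is $1$. In the degenerate case $p+q=0$ the exponent is $-1$, and the identity is understood only when the determinant being inverted is invertible. *)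

(* Defs.v *)
From mathcomp Require Import all_boot all_order all_algebra.

Set Implicit Arguments.
Unset Strict Implicit.
Unset Printing Implicit Defensive.

Import GRing.Theory.
Local Open Scope ring_scope.

Definition seqmx (R : Type) (m n : nat) (X : 'M[R]_(m, n))
    (s : seq 'I_m) (t : seq 'I_n) : 'M[R]_(size s, size t) :=
  mxsub (tnth (in_tuple s)) (tnth (in_tuple t)) X.

(* The sizes of [s] and [t] are in general only propositionally equal, whence
   the use of conform_mx; the value is meaningful only if size s = size t. *)
Definition minor (R : comPzRingType) (m n : nat) (X : 'M[R]_(m, n))
    (s : seq 'I_m) (t : seq 'I_n) : R :=
  \det (conform_mx (0 : 'M_(size s)) (seqmx X s t)).

Definition remove_nth (T : Type) (k : nat) (s : seq T) : seq T :=
  take k s ++ drop k.+1 s.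

Definition Xtilde (R : comPzRingType) (m n p q r : nat) (X : 'M[R]_(m, n))
    (I : p.-tuple 'I_m) (J : q.-tuple 'I_m) (K : r.-tuple 'I_m)
    (I' : p.-tuple 'I_n) (J' : q.-tuple 'I_n) (K' : r.-tuple 'I_n) :
    'M[R]_(p + q) :=
  block_mx
    (\matrix_(a < p, b < p)
       minor X ([:: tnth I a] ++ J ++ K) ([:: tnth I' b] ++ J' ++ K'))
    (\matrix_(a < p, b < q)
       minor X ([:: tnth I a] ++ remove_nth b J ++ K) (J' ++ K'))
    (\matrix_(a < q, b < p)
       minor X (J ++ K) ([:: tnth I' b] ++ remove_nth a J' ++ K'))
    (\matrix_(a < q, b < q)
       - minor X (remove_nth b J ++ K) (remove_nth a J' ++ K')).

Lemma det_conform_mx (R : comPzRingType) (a b k : nat) (ea : a = k)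
    (eb : b = k) (B : 'M[R]_a) (A : 'M[R]_(a, b)) :
  \det (conform_mx B A) = \det (castmx (ea, eb) A).
Proof. by subst k; subst b; rewrite conform_mx_id castmx_id. Qed.

Lemma minor_tuple (R : comPzRingType) (m n k : nat) (X : 'M[R]_(m, n))
    (s : k.-tuple 'I_m) (t : k.-tuple 'I_n) :
  minor X s t = \det (mxsub (tnth s) (tnth t) X).
Proof.
rewrite /minor (det_conform_mx (size_tuple s) (size_tuple t)).
congr (\det _); apply/matrixP => i j; rewrite castmxE !mxE.
have tnthE T (u : k.-tuple T) l :
    tnth (in_tuple u) (cast_ord (esym (size_tuple u)) l) = tnth u l.
  by have x := tnth u l; rewrite !(tnth_nth x).
by congr (X _ _); apply: tnthE.
Qed.

Lemma size_remove_nth (T : Type) (q : nat) (b : 'I_q) (s : q.-tuple T) :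
  size (remove_nth b s) = q.-1.
Proof.
rewrite size_cat size_take size_drop size_tuple ltn_ord.
by case: q b {s} => [[]//|q] b /=; rewrite subSS subnKC // -ltnS.
Qed.

(* Main.v *)
Require Import Defs.
From HB Require Import structures.
From mathcomp Require Import all_boot all_order all_algebra perm.

Set Implicit Arguments.
Unset Strict Implicit.
Unset Printing Implicit Defensive.

Import GRing.Theory.
Local Open Scope ring_scope.

(** Write M for the submatrix of X on rows J, K and columns J', K', and D for
    its determinant.  Every entry of Xtilde is given by the adjugate of M and the
    rows and columns of X that border M.  Indeed, a minor of M bordered by one
    row u, one column v and a corner x is D x - u (adj M) v (lemma
    [minor_cons]), and
    replacing one row or column of M amounts to multiplying by adj M (lemmas
    [minor_consl] and [minor_consr]); the remaining entries are cofactors of M.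
    Hence (lemma [Xtilde_schur])

      Xtilde = D A - B (adj M) C,

    the Schur complement of M, with denominators cleared, in the bordered matrix

                I'     *     J'    K'
         I   (  x      0     x     x  )
         *   (  0      0    -S     0  )
         J   (  x     -S     x     x  )
         K   (  x      0     x     x  )

    where x stands for blocks of X and S is the diagonal matrix of the signs
    (-1)^b, which absorbs the displacement of the new row of index i_a (or
    column of index i'_b) to the first position.

    Two determinant computations conclude.  The determinant of the Schur
    complement is the determinant of the bordered matrix times D^(p+q-1) (lemma
    [det_schur_adj]).  In the bordered matrix the blocks -S cancel the
    contributions of rows J and columns J', leaving the minor on rows I, K and
    columns I', K' times (-1)^q (det S)^2 = (-1)^q (lemma [det_bordered]). *)

(** * The Schur complement without division *)

(** This is block elimination of C, with adj M instead of the inverse of M: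
    the elimination matrix then has determinant (det M)^s. *)
Lemma det_schur_adj_mul (R : comPzRingType) (s k : nat) (A : 'M[R]_s)
    (B : 'M_(s, k)) (C : 'M_(k, s)) (M : 'M_k) :
  \det (\det M *: A - B *m \adj M *m C) * \det M =
    \det (block_mx A B C M) * \det M ^+ s.
Proof.
rewrite -[\det M ^+ s]mulr1 -(det1 R k) -det_scalar.
rewrite -(det_ublock _ B) -(det_lblock _ (- (\adj M *m C))) -det_mulmx.
rewrite mulmx_block.
congr (\det (block_mx _ _ _ _)); rewrite ?mulmx0 ?add0r ?mulmx1 //.
  by rewrite mulmxN mul_mx_scalar mulmxA.
by rewrite mulmxN mul_mx_scalar mulmxA mul_mx_adj mul_scalar_mx subrr.
Qed.

(** One factor det M may be cancelled in [det_schur_adj_mul] even if it is a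
    zero divisor: replace M by M + X over the polynomial ring, where the
    determinant is monic and hence regular, and then evaluate at X = 0. *)
Lemma det_schur_adj_nz (R : comNzRingType) (s k : nat) (A : 'M[R]_s)
    (B : 'M_(s, k)) (C : 'M_(k, s)) (M : 'M_k) :
  (0 < s)%N ->
  \det (\det M *: A - B *m \adj M *m C) =
    \det (block_mx A B C M) * \det M ^+ s.-1.
Proof.
move=> s_gt0; pose Mt := char_poly_mx (- M).
pose ev : {rmorphism {poly R} -> R} := horner_eval 0.
have regMt : GRing.rreg (\det Mt) by apply/monic_rreg/char_poly_monic.
have evC m n (Y : 'M[R]_(m, n)) : map_mx ev (map_mx polyC Y) = Y.
  by apply/matrixP=> i j; rewrite !mxE /= /horner_eval hornerC.
have evMt : map_mx ev Mt = M.
  apply/matrixP=> i j; rewrite !mxE /= /horner_eval.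
  by rewrite !hornerE hornerMn hornerX mul0rn sub0r opprK.
have := det_schur_adj_mul (map_mx polyC A) (map_mx polyC B) (map_mx polyC C) Mt.
rewrite -[X in _ ^+ X](prednK s_gt0) exprSr mulrA => /regMt /(congr1 ev).
rewrite rmorphM rmorphXn -!det_map_mx map_block_mx !evC evMt => <-.
rewrite map_mxB map_mxZ !map_mxM map_mx_adj !evC evMt.
by congr (\det (_ *: _ - _)); rewrite -[in LHS]evMt det_map_mx.
Qed.

Lemma det_schur_adj (R : comPzRingType) (s k : nat) (A : 'M[R]_s)
    (B : 'M_(s, k)) (C : 'M_(k, s)) (M : 'M_k) :
  (0 < s)%N ->
  \det (\det M *: A - B *m \adj M *m C) =
    \det (block_mx A B C M) * \det M ^+ s.-1.
Proof.
have [R0 | nzR] := eqVneq (1 : R) 0.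
  by rewrite -[LHS]mulr1 -[RHS]mulr1 R0 !mulr0.
(* Polynomials need a nontrivial coefficient ring. *)
pose nz := GRing.PzSemiRing_isNonZero.Build R nzR.
pose R' : comNzRingType := HB.pack (GRing.ComPzRing.sort R) nz.
exact: (@det_schur_adj_nz R').
Qed.

(** * The determinant of the bordered matrix *)

(** Applying the same permutation to rows and columns introduces its sign
    twice.  The sizes k and k' are kept apart so that f may relate two different
    ways of writing a sum of block sizes. *)
Lemma det_mxsub_inj (R : comPzRingType) (k k' : nat) (f : 'I_k -> 'I_k')
    (A : 'M[R]_k') :
  k = k' -> injective f -> \det (mxsub f f A) = \det A.
Proof.
move=> eq_k; case: k' / eq_k in f A * => injf.
have -> : mxsub f f A = row_perm (perm injf) (col_perm (perm injf) A).
  by apply/matrixP=> i j; rewrite !mxE !permE.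
rewrite row_permE col_permE !det_mulmx !det_perm odd_permV.
by rewrite mulrCA -signr_addb addbb mulr1.
Qed.

(** For four blocks of sizes p, q, q, r, this takes them in the order 2, 1, 4,
    3, in which the matrix of [det_bordered] becomes block triangular. *)
Definition block_reorder (p q r : nat) (l : 'I_(q + ((p + r) + q))) :
    'I_((p + q) + (q + r)) :=
  match split l with
  | inl d => lshift _ (rshift p d)
  | inr l' =>
    match split l' with
    | inl a =>
      match split a with
      | inl i => lshift _ (lshift q i)
      | inr k => rshift _ (rshift q k)
      end
    | inr j => rshift _ (lshift r j)
    end
  end.

Lemma block_reorder_inj (p q r : nat) : injective (@block_reorder p q r).
Proof.
pose g (l : 'I_((p + q) + (q + r))) : 'I_(q + ((p + r) + q)) :=
  match split l with
  | inl l' =>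
    match split l' with
    | inl i => rshift _ (lshift _ (lshift _ i))
    | inr d => lshift _ d
    end
  | inr l' =>
    match split l' with
    | inl j => rshift _ (rshift _ j)
    | inr k => rshift _ (lshift _ (rshift _ k))
    end
  end.
apply: (@can_inj _ _ _ g) => l; rewrite /block_reorder.
have lS a b (i : 'I_a) : split (lshift b i) = inl i by exact: (unsplitK (inl i)).
have rS a b (i : 'I_b) : split (rshift a i) = inr i by exact: (unsplitK (inr i)).
case: split_ordP => [d ->|{}l ->]; first by rewrite /g lS rS.
case: split_ordP => [{}l ->|j ->]; last by rewrite /g rS lS.
by case: split_ordP => [i ->|k ->]; rewrite /g ?lS ?rS.
Qed.

(** The second block row and the second block column have S and T as their only
    entries, in the third block column and the third block row.  Two column
    operations bring S and - T onto the diagonal; the sign (-1)^q comes from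
    det (- T).  The matrix is then block triangular in the order of
    [block_reorder]. *)
Lemma det_bordered (R : comPzRingType) (p q r : nat) (A : 'M[R]_p)
    (B1 : 'M_(p, q)) (B2 : 'M_(p, r)) (C1 : 'M_(q, p)) (C2 : 'M_(r, p))
    (M11 : 'M_q) (M12 : 'M_(q, r)) (M21 : 'M_(r, q)) (M22 : 'M_r)
    (S T : 'M_q) :
  \det (block_mx (block_mx A 0 0 0) (block_mx B1 B2 S 0)
                 (block_mx C1 T C2 0) (block_mx M11 M12 M21 M22)) =
  (-1) ^+ q * \det S * \det T * \det (block_mx A B2 C2 M22).
Proof.
(* E1 adds the third block column to the second one, E2 then subtracts the
   second from the third. *)
pose E1 : 'M[R]_((p + q) + (q + r)) :=
  block_mx 1%:M 0 (block_mx 0 1%:M 0 0) 1%:M.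
pose E2 : 'M[R]_((p + q) + (q + r)) :=
  block_mx 1%:M (block_mx 0 0 (- 1%:M) 0) 0 1%:M.
have dE1 : \det E1 = 1 by rewrite det_lblock !det1 mulr1.
have dE2 : \det E2 = 1 by rewrite det_ublock !det1 mulr1.
have dE N : \det N = \det (N *m E1 *m E2).
  by rewrite !det_mulmx dE1 dE2 !mulr1.
rewrite dE; set Q := _ *m E2.
have {Q}-> : Q = block_mx (block_mx A B1 0 S) (block_mx 0 B2 0 0)
                 (block_mx C1 (T + M11) C2 M21) (block_mx (- T) M12 0 M22).
  rewrite /Q !mulmx_block.
  rewrite !(mulmx0, mulmx1, mul0mx, addr0, add0r, add_block_mx, mulmxN, oppr0).
  rewrite !mulmx_block.
  rewrite !(mulmx0, mulmx1, addr0, add0r, add_block_mx, mulmxN).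
  by rewrite !addNr opprD addrNK.
have eq_k : (q + ((p + r) + q))%N = ((p + q) + (q + r))%N.
  by rewrite addnC -!addnA; congr (_ + _)%N; rewrite addnC -addnA.
rewrite -(det_mxsub_inj _ eq_k (@block_reorder_inj p q r)).
set Q := mxsub _ _ _.
have {Q}-> : Q = block_mx S 0 (col_mx (col_mx B1 M21) (T + M11))
   (block_mx (block_mx A B2 C2 M22) 0 (row_mx C1 M12) (- T)).
  apply/matrixP=> i j; rewrite mxE /block_reorder.
  case: (split_ordP i) => {}i ->; last case: (split_ordP i) => {}i ->;
    try case: (split_ordP i) => {}i ->;
  case: (split_ordP j) => {}j ->; try case: (split_ordP j) => {}j ->;
    try case: (split_ordP j) => {}j ->;
  by rewrite !(block_mxEul, block_mxEur, block_mxEdl, block_mxEdr,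
               col_mxEu, col_mxEd, row_mxEl, row_mxEr, mxE).
rewrite !det_lblock -scaleN1r detZ mulrC -!mulrA mulrCA; congr (_ * _).
by rewrite [LHS]mulrC -[LHS]mulrA [LHS]mulrCA.
Qed.

(** * Minors along sequences of indices *)

Lemma nth_remove_nth (T : Type) (x0 : T) (a i : nat) (s : seq T) :
  (a < size s)%N -> nth x0 (remove_nth a s) i = nth x0 s (bump a i).
Proof.
move=> lt_a; rewrite nth_cat size_take lt_a /bump.
by case: ltnP => [lt_i|le_i]; rewrite ?nth_take ?nth_drop // addSn subnKC.
Qed.

Lemma remove_nth_cat (T : Type) (a : nat) (s t : seq T) :
  (a < size s)%N -> remove_nth a (s ++ t) = remove_nth a s ++ t.
Proof.
move=> lt_a; rewrite /remove_nth take_cat lt_a drop_cat -catA.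
case: ltnP => // le_s.
have -> : a.+1 = size s by apply/eqP; rewrite eqn_leq lt_a.
by rewrite subnn drop0 drop_size.
Qed.

Lemma minor_tr (R : comPzRingType) (m n k : nat) (X : 'M[R]_(m, n))
    (s : k.-tuple 'I_m) (t : k.-tuple 'I_n) : minor X^T t s = minor X s t.
Proof. by rewrite !minor_tuple -trmx_mxsub det_tr. Qed.

Lemma mxsub_cat (R : Type) (m n p q p' q' : nat) (X : 'M[R]_(m, n))
    (s : p.-tuple 'I_m) (s' : q.-tuple 'I_m)
    (t : p'.-tuple 'I_n) (t' : q'.-tuple 'I_n) :
  mxsub (tnth [tuple of s ++ s']) (tnth [tuple of t ++ t']) X =
    block_mx (mxsub (tnth s) (tnth t) X) (mxsub (tnth s) (tnth t') X)
             (mxsub (tnth s') (tnth t) X) (mxsub (tnth s') (tnth t') X).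
Proof.
apply/matrixP => i j; rewrite mxE.
by case: (split_ordP i) => {}i ->; case: (split_ordP j) => {}j ->;
  rewrite ?(block_mxEul, block_mxEur, block_mxEdl, block_mxEdr) !mxE
          ?tnth_lshift ?tnth_rshift.
Qed.

Lemma minor_cat (R : comPzRingType) (m n p q : nat) (X : 'M[R]_(m, n))
    (s : p.-tuple 'I_m) (s' : q.-tuple 'I_m)
    (t : p.-tuple 'I_n) (t' : q.-tuple 'I_n) :
  minor X (s ++ s') (t ++ t') =
    \det (block_mx (mxsub (tnth s) (tnth t) X) (mxsub (tnth s) (tnth t') X)
                   (mxsub (tnth s') (tnth t) X) (mxsub (tnth s') (tnth t') X)).
Proof.
by rewrite (minor_tuple X [tuple of s ++ s'] [tuple of t ++ t']) mxsub_cat.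
Qed.

Lemma cofactor_minor (R : comPzRingType) (m n k : nat) (X : 'M[R]_(m, n))
    (s : k.-tuple 'I_m) (t : k.-tuple 'I_n) (a b : 'I_k) :
  cofactor (mxsub (tnth s) (tnth t) X) a b =
    (-1) ^+ (a + b) * minor X (remove_nth a s) (remove_nth b t).
Proof.
have eq_s := introT eqP (size_remove_nth a s).
have eq_t := introT eqP (size_remove_nth b t).
rewrite (minor_tuple X (Tuple eq_s) (Tuple eq_t)); congr (_ * \det _).
apply/matrixP => i j; rewrite !mxE.
have tnthE T (u : k.-tuple T) (c : 'I_k)
    (eq_u : size (remove_nth c u) == k.-1) l :
  tnth u (lift c l) = tnth (Tuple eq_u) l.
  have x0 := tnth u c.
  by rewrite !(tnth_nth x0) /= nth_remove_nth // size_tuple.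
by congr (X _ _); apply: tnthE.
Qed.

(** The case s = 1 of [det_schur_adj]. *)
Lemma minor_cons (R : comPzRingType) (m n k : nat) (X : 'M[R]_(m, n))
    (s : k.-tuple 'I_m) (t : k.-tuple 'I_n) (i : 'I_m) (j : 'I_n) :
  minor X (i :: s) (j :: t) =
    \det (mxsub (tnth s) (tnth t) X) * X i j
    - (mxsub (fun=> i) (tnth t) X *m \adj (mxsub (tnth s) (tnth t) X)
       *m mxsub (tnth s) (fun=> j) X) (ord0 : 'I_1) (ord0 : 'I_1).
Proof.
have := det_schur_adj (mxsub (fun=> i) (fun=> j) X : 'M_1)
  (mxsub (fun=> i) (tnth t) X) (mxsub (tnth s) (fun=> j) X)
  (mxsub (tnth s) (tnth t) X) isT.
rewrite expr0 mulr1 det_mx11 !mxE => ->.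
rewrite (minor_cat X [tuple i] s [tuple j] t).
by congr (\det (block_mx _ _ _ _)); apply/matrixP=> a b;
  rewrite !mxE ?ord1 ?tnth0.
Qed.

(** Cramer's rule: expanding along the new row i gives the minors that form
    column b of the adjugate, since both omit row b of s; the sign (-1)^b
    accounts for i standing in position 0 rather than b. *)
Lemma minor_consl (R : comPzRingType) (m n k : nat) (X : 'M[R]_(m, n))
    (s : k.-tuple 'I_m) (t : k.-tuple 'I_n) (i : 'I_m) (b : 'I_k) :
  minor X (i :: remove_nth b s) t =
    (-1) ^+ b * \sum_l X i (tnth t l) * \adj (mxsub (tnth s) (tnth t) X) l b.
Proof.
case: k => [|k] in s t b *; first by case: b.
have sz_s := introT eqP (size_remove_nth b s).
rewrite (minor_tuple X (cons_tuple i (Tuple sz_s))) (expand_det_row _ ord0).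
rewrite mulr_sumr; apply: eq_bigr => l _.
rewrite cofactor_minor !mxE cofactor_minor tnth0 [RHS]mulrCA; congr (_ * _).
by rewrite add0n exprD -[in RHS]mulrA signrMK /remove_nth /= drop0.
Qed.

Lemma minor_consr (R : comPzRingType) (m n k : nat) (X : 'M[R]_(m, n))
    (s : k.-tuple 'I_m) (t : k.-tuple 'I_n) (j : 'I_n) (a : 'I_k) :
  minor X s (j :: remove_nth a t) =
    (-1) ^+ a * \sum_l \adj (mxsub (tnth s) (tnth t) X) a l * X (tnth s l) j.
Proof.
have := minor_consl X^T t s j a.
case: k => [|k] in s t a *; first by case: a.
have sz_t := introT eqP (size_remove_nth a t).
rewrite (minor_tr X s (cons_tuple j (Tuple sz_t))) => ->.
congr (_ * _); apply: eq_bigr => l _.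
by rewrite -trmx_mxsub -trmx_adj !mxE mulrC.
Qed.

(** * The matrix of minors as a Schur complement *)

Lemma mulmx_diag_pad (R : pzSemiRingType) (m q r : nat) (d : 'rV[R]_q)
    (N : 'M_(m, q + r)) i j :
  (N *m col_mx (diag_mx d) 0) i j = N i (lshift r j) * d 0 j.
Proof.
by rewrite -[N in LHS]hsubmxK mul_row_col mulmx0 addr0 mul_mx_diag !mxE.
Qed.

Lemma mul_diag_pad_mx (R : pzSemiRingType) (n q r : nat) (d : 'rV[R]_q)
    (N : 'M_(q + r, n)) i j :
  (row_mx (diag_mx d) 0 *m N) i j = d 0 i * N (lshift r i) j.
Proof.
by rewrite -[N in LHS]vsubmxK mul_row_col mul0mx addr0 mul_diag_mx !mxE.
Qed.

Definition alt_signs (R : pzRingType) (q : nat) : 'rV[R]_q :=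
  \row_b (-1) ^+ b.

Lemma det_alt_signs_sqr (R : comPzRingType) (q : nat) :
  \det (diag_mx (alt_signs R q)) * \det (diag_mx (alt_signs R q)) = 1.
Proof.
rewrite det_diag -big_split big1 // => b _.
by rewrite !mxE /= -expr2 sqrr_sign.
Qed.

(** The borders - S select, with signs, the part of adj M that is indexed by J
    and J'; two of them occur in the lower right block, whence its minus
    sign. *)
Lemma Xtilde_schur (R : comPzRingType) (m n p q r : nat) (X : 'M[R]_(m, n))
    (I : p.-tuple 'I_m) (J : q.-tuple 'I_m) (K : r.-tuple 'I_m)
    (I' : p.-tuple 'I_n) (J' : q.-tuple 'I_n) (K' : r.-tuple 'I_n) :
  let M := mxsub (tnth [tuple of J ++ K]) (tnth [tuple of J' ++ K']) X in
  let S := diag_mx (alt_signs R q) in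
  Xtilde X I J K I' J' K' =
    \det M *: block_mx (mxsub (tnth I) (tnth I') X) 0 0 0
    - block_mx (mxsub (tnth I) (tnth J') X) (mxsub (tnth I) (tnth K') X)
               (- S) 0
      *m \adj M
      *m block_mx (mxsub (tnth J) (tnth I') X) (- S)
                  (mxsub (tnth K) (tnth I') X) 0.
Proof.
move=> M S.
have -> : block_mx (mxsub (tnth I) (tnth J') X) (mxsub (tnth I) (tnth K') X)
                   (- S) 0
    = col_mx (mxsub (tnth I) (tnth [tuple of J' ++ K']) X)
             (- row_mx S 0) :> 'M_(p + q, q + r).
  rewrite opp_row_mx oppr0; congr (col_mx _ _); apply/matrixP=> i j.
  by case: (split_ordP j) => {}j ->;
    rewrite ?row_mxEl ?row_mxEr !mxE ?tnth_lshift ?tnth_rshift.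
have -> : block_mx (mxsub (tnth J) (tnth I') X) (- S)
                   (mxsub (tnth K) (tnth I') X) 0
    = row_mx (mxsub (tnth [tuple of J ++ K]) (tnth I') X)
             (- col_mx S 0) :> 'M_(q + r, p + q).
  rewrite block_mxEh opp_col_mx oppr0; congr (row_mx _ _); apply/matrixP=> i j.
  by case: (split_ordP i) => {}i ->;
    rewrite ?col_mxEu ?col_mxEd !mxE ?tnth_lshift ?tnth_rshift.
rewrite mul_col_mx mul_col_row scale_block_mx opp_block_mx add_block_mx.
rewrite !scaler0 !add0r !mulmxN !mulNmx !opprK.
congr block_mx; apply/matrixP=> a b.
- rewrite mxE (minor_cons X [tuple of J ++ K] [tuple of J' ++ K']) -/M !mxE.
  congr (_ - _); apply: eq_bigr => l _; rewrite !mxE; congr (_ * _).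
  by apply: eq_bigr => u _; rewrite !mxE.
- rewrite mulmx_diag_pad !mxE -remove_nth_cat ?size_tuple //.
  rewrite (minor_consl X [tuple of J ++ K] [tuple of J' ++ K'] _ (lshift r b)).
  by rewrite mulrC; congr (_ * _); apply: eq_bigr => l _; rewrite [in RHS]mxE.
- rewrite -mulmxA mul_diag_pad_mx !mxE -remove_nth_cat ?size_tuple //.
  rewrite (minor_consr X [tuple of J ++ K] [tuple of J' ++ K'] _ (lshift r a)).
  by congr (_ * _); apply: eq_bigr => l _; rewrite [in X in _ = _ * X]mxE.
- rewrite mxE [in RHS]mxE mulmx_diag_pad mul_diag_pad_mx !mxE.
  rewrite cofactor_minor !remove_nth_cat ?size_tuple //=.
  by rewrite addnC exprD -!mulrA signrMK [minor _ _ _ * _]mulrC signrMK.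
Qed.

Theorem theorem1p2 (R : comPzRingType) (m n : nat) (X : 'M[R]_(m, n))
    (p q r : nat)
    (I : p.-tuple 'I_m) (J : q.-tuple 'I_m) (K : r.-tuple 'I_m)
    (I' : p.-tuple 'I_n) (J' : q.-tuple 'I_n) (K' : r.-tuple 'I_n) :
  ((0 < p + q)%N ->
     \det (Xtilde X I J K I' J' K') =
       (-1) ^+ q * minor X (I ++ K) (I' ++ K')
         * minor X (J ++ K) (J' ++ K') ^+ (p + q - 1))
  /\
  ((p + q = 0)%N -> forall u : R, minor X (J ++ K) (J' ++ K') * u = 1 ->
     \det (Xtilde X I J K I' J' K') =
       (-1) ^+ q * minor X (I ++ K) (I' ++ K') * u).
Proof.
split=> [pq_gt0|pq0 u Du].
  rewrite Xtilde_schur det_schur_adj // mxsub_cat det_bordered subn1.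
  rewrite -scaleN1r !detZ mulrACA -!mulrA -!minor_cat signrMK.
  by congr (_ * _); rewrite mulrA det_alt_signs_sqr mul1r.
(* Here Xtilde is empty and both minors are the one on rows K, columns K'. *)
case: p q pq0 => [|//] [|//] _ in I I' J J' Du *.
rewrite (tuple0 I) (tuple0 I') (tuple0 J) (tuple0 J') in Du *.
by rewrite det_mx00 expr0 mul1r.
Qed.
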